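(* Let $\Sigma$ be a $2$-chromatic signed graph. Then: (1) $\operatorname{M}(\Sigma)=1=\operatorname{m}(\Sigma)$ if and only if $\Sigma$ is connected and all negative (every edge of $\Sigma$ is negative); (2) $\operatorname{M}(\Sigma)=0=\operatorname{m}(\Sigma)$ if and only if $\Sigma$ contains a positive edge; (3) $\operatorname{M}(\Sigma)=1$ and $\operatorname{m}(\Sigma)=0$ if and only if $\Sigma$ is disconnected and all negative.
   Context: A signed graph $\Sigma=(V,E,\sigma)$ is a finite graph $(V,E)$ with a signature $\sigma:E\to\{+,-\}$. Graphs are simple: no loops and no multiple edges. A proper coloration is a function $\kappa:V\to\{\pm1,\dots,\pm k\}$ or $\kappa:V\to\{\pm1,\dots,\pm k,0\}$ such that $\kappa(a)\neq\sigma(e)\kappa(b)$ for every edge $e$ with endpoints $a,b$. The color set of size $2k$ is $\{\pm1,\dots,\pm k\}$ and the color set of size $2k+1$ is $\{\pm1,\dots,\pm k,0\}$. The chromatic number $\chi(\Sigma)$ is the size of the smallest such color set from which $\Sigma$ can be properly colored; $\Sigma$ is $k$-chromatic if $\chi(\Sigma)=k$. A coloration is minimal if it is proper and its color set is the one of size $\chi(\Sigma)$. The deficiency $\operatorname{def}(\kappa)$ of a minimal coloration is the number of colors of its color set that are not used by $\kappa$. The maximum deficiency $\operatorname{M}(\Sigma)$ and minimum deficiency $\operatorname{m}(\Sigma)$ are the maximum and minimum of $\operatorname{def}(\kappa)$ over all minimal proper colorations $\kappa$ of $\Sigma$. *)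

(* Defs.v *)
From HB Require Import structures.
From mathcomp Require Import all_boot all_order all_algebra.
Set Implicit Arguments.
Unset Strict Implicit.
Unset Printing Implicit Defensive.
Import Order.TTheory GRing.Theory Num.Theory.
Local Open Scope ring_scope.

(* An edge is a two-element set of vertices.  Signs are booleans, [true] being
   the sign -, so that the sign s acts on colors as multiplication by
   (-1) ^+ s. *)
Record signed_graph := SignedGraph {
  vertex :> finType;
  edges : {set {set vertex}};
  edges_card : forall e, e \in edges -> #|e| = 2%N;
  signature : {e : {set vertex} | e \in edges} -> bool }.

Definition edge (G : signed_graph) : finType :=
  {e : {set G} | e \in edges G}.

Definition positive (G : signed_graph) (e : edge G) : bool := ~~ signature e.
Definition negative (G : signed_graph) (e : edge G) : bool := signature e.

Definition all_negative (G : signed_graph) : Prop :=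
  forall e : edge G, negative e.

Definition has_positive_edge (G : signed_graph) : Prop :=
  exists e : edge G, positive e.

Definition adjacent (G : signed_graph) : rel G :=
  [rel a b | [set a; b] \in edges G].

Definition connected (G : signed_graph) : Prop :=
  forall a b : G, connect (@adjacent G) a b.

(* The color set of size n: 1, -1, ..., k, -k with k = n./2, and 0 if n is
   odd. *)
Definition color_set (n : nat) : seq int :=
  nseq (odd n) 0 ++ [seq i%:Z | i <- iota 1 n./2]
                 ++ [seq - i%:Z | i <- iota 1 n./2].

Lemma size_color_set n : size (color_set n) = n.
Proof.
by rewrite !size_cat size_nseq !size_map size_iota addnn odd_double_half.
Qed.

Lemma mem_color_set n (c : int) :
  (c \in color_set n) = if c == 0 then odd n else (`|c| <= n./2)%N.
Proof.
rewrite !mem_cat mem_nseq lt0b.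
have H1 : (c \in [seq i%:Z | i <- iota 1 n./2]) = (0 < c) && (`|c| <= n./2)%N.
  apply/mapP/andP => [[i]|[c0 cn]].
    by rewrite mem_iota add1n ltnS => /andP[i0 ik] ->; rewrite ltz_nat.
  by exists `|c|%N; [rewrite mem_iota add1n ltnS absz_gt0 gt_eqF | rewrite gtz0_abs].
have H2 : (c \in [seq - i%:Z | i <- iota 1 n./2]) = (c < 0) && (`|c| <= n./2)%N.
  apply/mapP/andP => [[i]|[c0 cn]].
    rewrite mem_iota add1n ltnS => /andP[i0 ik] ->.
    by rewrite oppr_lt0 ltz_nat abszN.
  exists `|c|%N; first by rewrite mem_iota add1n ltnS absz_gt0 lt_eqF.
  by rewrite ltz0_abs ?opprK.
by rewrite H1 H2; case: (ltgtP c 0) => c0; rewrite ?andbF ?orbF ?andbT.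
Qed.

Lemma uniq_color_set n : uniq (color_set n).
Proof.
have pU : uniq [seq i%:Z | i <- iota 1 n./2].
  by rewrite map_inj_uniq ?iota_uniq // => i j [].
have nU : uniq [seq - i%:Z | i <- iota 1 n./2].
  by rewrite map_inj_uniq ?iota_uniq // => i j /oppr_inj[].
rewrite !cat_uniq pU nU andbT /= has_cat.
apply/and3P; split; first by case: (odd n).
  rewrite negb_or; apply/andP; split; apply/hasPn => _ /mapP[i + ->];
    by rewrite mem_iota mem_nseq => /andP[i0 _]; rewrite ?oppr_eq0 eqz_nat
      gtn_eqF // andbF.
apply/hasPn => _ /mapP[i + ->]; rewrite mem_iota => /andP[i0 _].
by apply/mapP => -[j _ /eqP]; rewrite lt_eqF // (@lt_le_trans _ _ 0) // oppr_lt0.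
Qed.

Definition color (n : nat) : finType := seq_sub (color_set n).

Definition coloration (G : signed_graph) (n : nat) := {ffun G -> color n}.

Definition proper (G : signed_graph) (n : nat) (kappa : coloration G n) : bool :=
  [forall e : edge G, forall a : G, forall b : G,
     (val e == [set a; b]) ==>
       (val (kappa a) != (-1) ^+ signature e * val (kappa b))].

Definition colorable (G : signed_graph) (n : nat) : bool :=
  [exists kappa : coloration G n, proper kappa].

Lemma colorable_ex (G : signed_graph) : exists n, colorable G n.
Proof.
exists (#|G|.*2).
have Hc (v : G) : (enum_rank v).+1%:Z \in color_set #|G|.*2.
  by rewrite mem_color_set /= doubleK ltn_ord.
apply/existsP; exists [ffun v => SeqSub (Hc v)].
apply/forallP => e; apply/forallP => a; apply/forallP => b.
apply/implyP => /eqP eab; rewrite !ffunE /=.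
case: (signature e); rewrite ?expr1 ?mulN1r // expr0 mul1r.
apply/eqP => -[/val_inj/enum_rank_inj ab].
by have := edges_card (valP e); rewrite eab ab setUid cards1.
Qed.

Definition chi (G : signed_graph) : nat := ex_minn (colorable_ex G).

Definition minimal_coloration (G : signed_graph) := coloration G (chi G).

Definition deficiency (G : signed_graph) (kappa : minimal_coloration G) : nat :=
  #|[set c : color (chi G) | c \notin codom kappa]|.

Definition is_deficiency (G : signed_graph) (d : nat) : bool :=
  [exists kappa : minimal_coloration G, proper kappa && (deficiency kappa == d)].

Lemma is_deficiency_ex (G : signed_graph) : exists d, is_deficiency G d.
Proof.
have : colorable G (chi G) by rewrite /chi; case: ex_minnP.
move=> /existsP[kappa kP]; exists (deficiency kappa).
by apply/existsP; exists kappa; rewrite kP eqxx.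
Qed.

Lemma is_deficiency_le (G : signed_graph) (d : nat) :
  is_deficiency G d -> (d <= chi G)%N.
Proof.
move=> /existsP[kappa /andP[_ /eqP <-]]; apply: leq_trans (max_card _) _.
by rewrite card_seq_sub ?uniq_color_set // size_color_set.
Qed.

Definition max_deficiency (G : signed_graph) : nat :=
  ex_maxn (is_deficiency_ex G) (@is_deficiency_le G).

Definition min_deficiency (G : signed_graph) : nat :=
  ex_minn (is_deficiency_ex G).

(* Main.v *)
Require Import Defs.
From mathcomp Require Import all_boot all_order all_algebra.
Set Implicit Arguments.
Unset Strict Implicit.
Unset Printing Implicit Defensive.

(* With colors 1 and -1, the ends of a negative edge get equal colors and those
   of a positive edge opposite colors.  Hence some minimal coloration misses
   a color (i.e., is constant) if and only if the graph is all negative.  All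
   minimal colorations miss a color if and only if, in addition, the graph is
   connected: otherwise 1 on a component and -1 on its complement is proper. *)

Lemma sign_color (x : bool) : ((-1) ^+ x)%R \in color_set 2.
Proof. by case: x. Qed.

(* As in the definition of signatures, [true] encodes -1. *)
Definition color_of_sign (x : bool) : color 2 := SeqSub (sign_color x).

Lemma color_of_sign_inj : injective color_of_sign.
Proof. by move=> [] [] // /(congr1 val). Qed.

Lemma color_of_sign_bij : bijective color_of_sign.
Proof.
apply: inj_card_bij color_of_sign_inj _.
by rewrite card_bool card_seq_sub ?uniq_color_set ?size_color_set.
Qed.

Definition sign_proper (G : signed_graph) (f : G -> bool) : Prop :=
  forall (e : edge G) (a b : G), val e = [set a; b] -> f a (+) f b = positive e.

(** Two distinct colors among 1 and -1 are opposite, so each inequation of properness turns into an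
    equation between booleans. *)
Lemma proper_sign (G : signed_graph) (kappa : coloration G 2) (f : G -> bool) :
  kappa =1 color_of_sign \o f -> Defs.proper kappa <-> sign_proper f.
Proof.
move=> kf.
have cE (s x y : bool) :
  ((-1) ^+ x != (-1) ^+ s * (-1) ^+ y :> int)%R = (x (+) y == ~~ s).
  by case: s x y => [] [] [].
split=> [/forallP kP e a b /eqP eab | fP].
  have /forallP/(_ a)/forallP/(_ b) := kP e.
  by rewrite eab /= !kf /= cE => /eqP.
apply/forallP=> e; apply/forallP=> a; apply/forallP=> b; apply/implyP=> /eqP.
by move=> /fP fab; rewrite !kf /= cE fab eqxx.
Qed.

Lemma card_unused_sign (G : signed_graph) (kappa : coloration G 2)
    (f : G -> bool) :
  kappa =1 color_of_sign \o f ->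
  #|[set c : color 2 | c \notin codom kappa]| = #|[predC codom f]|.
Proof.
move=> kf; rewrite -(card_imset _ color_of_sign_inj); apply: eq_card => c.
have [g gK Kg] := color_of_sign_bij.
rewrite -(Kg c) mem_imset ?inE; last exact: color_of_sign_inj.
by rewrite (eq_codom kf) codomE map_comp -codomE mem_map //; exact: color_of_sign_inj.
Qed.

(** The type of minimal colorations depends on [chi G]; a variable [n] equal to it lets colorations
    be typed with the literal 2, without transport. *)
Lemma is_deficiencyP (G : signed_graph) (n d : nat) : chi G = n ->
  is_deficiency G d <-> exists2 kappa : coloration G n,
    Defs.proper kappa & #|[set c : color n | c \notin codom kappa]| = d.
Proof.
move=> <-; split=> [/existsP[kappa /andP[kP /eqP kd]] | [kappa kP kd]].
  by exists kappa.
by apply/existsP; exists kappa; rewrite kP; apply/eqP.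
Qed.

Lemma connectedP (G : signed_graph) :
  reflect (connected G) [forall a, forall b, connect (@adjacent G) a b].
Proof. by apply: (iffP forallP) => conn a; apply/forallP/conn. Qed.

Section TwoChromatic.

Variable G : signed_graph.
Hypothesis chiG : chi G = 2.

Lemma is_deficiency_sign (d : nat) :
  is_deficiency G d <-> exists2 f : G -> bool,
    sign_proper f & #|[predC codom f]| = d.
Proof.
split=> [/(is_deficiencyP d chiG)[kappa kP <-] | [f fP <-]].
  have [g gK Kg] := color_of_sign_bij.
  have kf : kappa =1 color_of_sign \o (g \o kappa) by move=> a /=; rewrite Kg.
  exists (g \o kappa); first exact/(proper_sign kf).
  by rewrite (card_unused_sign kf).
have kf : [ffun a => color_of_sign (f a)] =1 color_of_sign \o f.
  by move=> a; rewrite ffunE.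
apply/(is_deficiencyP _ chiG).
exists [ffun a => color_of_sign (f a)]; first exact/(proper_sign kf).
exact: card_unused_sign.
Qed.

(** A graph without vertices is colorable from the empty color set, so its chromatic number is 0. *)
Lemma chi2_vertex : exists a : G, true.
Proof.
case: (pickP [pred a : G | true]) => [a _ | G0]; first by exists a.
have : colorable G 0.
  apply/existsP; exists (ffun0 (eq_card0 G0)).
  by apply/forallP=> e; apply/forallP=> a; have := G0 a.
by move: chiG; rewrite /chi; case: ex_minnP => n _ + n2 => /[apply]; rewrite n2.
Qed.

Lemma card_unused_sign_le1 (f : G -> bool) : #|[predC codom f]| <= 1.
Proof.
have [a _] := chi2_vertex.
have : f a \in codom f by apply: codom_f.
have := cardC (mem (codom f)); rewrite card_bool => cE faf.
by rewrite -ltnS -[ltnRHS]cE -[ltnLHS]add0n ltn_add2r; apply/card_gt0P; exists (f a).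
Qed.

Lemma card_unused_sign1P (f : G -> bool) :
  #|[predC codom f]| = 1 <-> forall a b, f a = f b.
Proof.
split=> [f1 a b | fc].
  have /card_gt0P[x] : 0 < #|[predC codom f]| by rewrite f1.
  rewrite inE /= => xf.
  (* A missed value [x] leaves only the other boolean for every vertex. *)
  have fE c : f c = ~~ x.
    apply: contraNeq xf => fcx; have -> : x = f c by case: x (f c) fcx => [] [].
    exact: codom_f.
  by rewrite !fE.
have [a _] := chi2_vertex.
apply/eqP; rewrite eqn_leq card_unused_sign_le1; apply/card_gt0P.
exists (~~ f a); rewrite inE; apply/negP => /codomP[b].
by rewrite (fc b a); case: (f a).
Qed.

Lemma is_deficiency_le1 (d : nat) : is_deficiency G d -> d <= 1.
Proof. by move=> /is_deficiency_sign[f _ <-]; apply: card_unused_sign_le1. Qed.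

(** Missing a color means being constant, and a constant [f] has zero sum over the ends of each
    edge, which is what a negative edge requires. *)
Lemma is_deficiency1 : is_deficiency G 1 <-> all_negative G.
Proof.
split=> [/is_deficiency_sign[f fP /card_unused_sign1P fc] e | neg].
  have /cards2P[a [b [_ eab]]] : #|val e| == 2 by rewrite (edges_card (valP e)).
  by have := fP _ _ _ eab; rewrite (fc a b) addbb => /esym/negbFE.
apply/is_deficiency_sign; exists (fun=> false); last exact/card_unused_sign1P.
by move=> e a b _; rewrite /positive (neg e : signature e).
Qed.

(** Both sides say that [f] agrees on adjacent vertices; closedness gives access to the theory of
    [connect]. *)
Lemma sign_proper_closed (f : G -> bool) :
  all_negative G -> sign_proper f <-> closed (@adjacent G) f.
Proof.
move=> neg; split=> [fP a b ab | fcl e a b eab].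
  have := fP (Sub [set a; b] ab) a b (erefl _).
  rewrite /positive (neg _ : signature _) !unfold_in.
  by case: (f a) (f b) => [] [].
have ab : adjacent a b by rewrite /adjacent /= -eab (valP e).
by have := fcl _ _ ab; rewrite !unfold_in /positive (neg e : signature e) => ->;
  rewrite addbb.
Qed.

Lemma is_deficiency0 :
  is_deficiency G 0 <-> ~ (connected G /\ all_negative G).
Proof.
split=> [/is_deficiency_sign[f fP f0] [conn neg] | nconn].
  have /card_unused_sign1P : forall a b, f a = f b.
    move=> a b; apply: closed_connect (conn a b).
    exact/sign_proper_closed.
  by rewrite f0.
(* If 1 is not a deficiency, the one that exists must be 0, being at most 1. *)
have [/is_deficiency1 neg | /negP ndef1] := boolP (is_deficiency G 1); last first.
  have [d def_d] := is_deficiency_ex G.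
  by case: d def_d (is_deficiency_le1 def_d) => [|[|d]].
have /connectedP : ~ connected G by move=> conn; apply: nconn.
move=> /forallPn[a /forallPn[b /negP nab]].
apply/is_deficiency_sign; exists (connect (@adjacent G) a).
  apply/sign_proper_closed=> //; apply/connect_closed/sym_connect_sym.
  by move=> x y; rewrite /adjacent /= setUC.
(* Deficiency 1 would make the component's indicator constant, yet it holds at [a] and fails at
   [b]. *)
have := card_unused_sign_le1 (connect (@adjacent G) a).
rewrite leq_eqVlt ltnS leqn0 => /orP[/eqP/card_unused_sign1P/(_ a b) | /eqP //].
by rewrite connect0 => /esym.
Qed.

(** The truth value is read as 0 or 1, the only possible deficiencies; at least one of them
    occurs. *)
Lemma max_deficiency_chi2 : max_deficiency G = is_deficiency G 1.
Proof.
rewrite /max_deficiency; case: ex_maxnP => d def_d d_max.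
case: d def_d (is_deficiency_le1 def_d) d_max => [|[|d]] //= def_d _ d_max.
  by case: (boolP (is_deficiency G 1)) => // /d_max.
by rewrite def_d.
Qed.

Lemma min_deficiency_chi2 : min_deficiency G = ~~ is_deficiency G 0.
Proof.
rewrite /min_deficiency; case: ex_minnP => d def_d d_min.
case: d def_d (is_deficiency_le1 def_d) d_min => [|[|d]] //= def_d _ d_min.
  by rewrite def_d.
by case: (boolP (is_deficiency G 0)) => // /d_min.
Qed.

End TwoChromatic.

Lemma has_positive_edgeP (G : signed_graph) :
  has_positive_edge G <-> ~ all_negative G.
Proof.
split=> [[e /negP epos] neg | nneg]; first exact: epos (neg e).
have [/forallP // | /forallPn[e epos]] := boolP [forall e : edge G, negative e].
by exists e.
Qed.

Theorem theorem2p1 (G : signed_graph) (hchi : chi G = 2) :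
  [/\ (max_deficiency G = 1 /\ min_deficiency G = 1) <->
        (connected G /\ all_negative G),
      (max_deficiency G = 0 /\ min_deficiency G = 0) <->
        has_positive_edge G
    & (max_deficiency G = 1 /\ min_deficiency G = 0) <->
        (~ connected G /\ all_negative G)].
Proof.
rewrite max_deficiency_chi2 // min_deficiency_chi2 //.
(* What remains is propositional in connectedness and the two truth values; [absurd] and [triv] let
   [intuition] handle booleans used as propositions. *)
have := is_deficiency0 hchi; have := is_deficiency1 hchi.
have := has_positive_edgeP G; have absurd : ~ false by []; have triv := isT.
by case: (connectedP G) => conn; case: (is_deficiency G 1);
  case: (is_deficiency G 0) => /= posP neg1 nconn0; split; intuition.
Qed.
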